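(* Let $D\ge 0$ be an integer and let $M$ be an $m\times n$ binary $D$-disjunct matrix with $n\ge D+1$. Then the code with parity-check matrix $M$ has stopping distance $s_{\min}(M)\ge D+2$.
   Context: A binary matrix $M$ is $D$-disjunct if, for any $D+1$ (distinct) columns of $M$ with one column designated, there is a row with a $1$ in the designated column and a $0$ in each of the other $D$ columns. A stopping set of a binary matrix $M$ is a nonempty set $\mathcal{V}$ of columns of $M$ such that no row of $M$, when restricted to the columns in $\mathcal{V}$, has weight exactly $1$ (i.e. exactly one entry equal to $1$). The stopping distance $s_{\min}(M)$ is the smallest size of a stopping set of $M$, taken to be $\infty$ if there are none. *)

(* Defs.v *)
From mathcomp Require Import all_boot all_order all_algebra.
From mathcomp Require Import constructive_ereal.

Set Implicit Arguments.
Unset Strict Implicit.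
Unset Printing Implicit Defensive.

Import Order.TTheory GRing.Theory Num.Theory.
Local Open Scope ring_scope.

(* Columns of M are indexed by 'I_n, so two columns with different indices are
   distinct columns even when their entries agree. *)
Definition disjunct (D m n : nat) (M : 'M['F_2]_(m, n)) : Prop :=
  forall (C : {set 'I_n}) (j : 'I_n), #|C| = D.+1 -> j \in C ->
    exists i : 'I_m, M i j = 1 /\ (forall k, k \in C :\ j -> M i k = 0).

Definition row_weight (m n : nat) (M : 'M['F_2]_(m, n)) (V : {set 'I_n})
    (i : 'I_m) : nat :=
  #|[set j in V | M i j == 1]|.

Definition stopping_set (m n : nat) (M : 'M['F_2]_(m, n)) (V : {set 'I_n}) :
    bool :=
  (V != set0) && [forall i, row_weight M V i != 1%N].

(* An extended number rather than a nat: the minimum over an empty family is +oo. *)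
Definition stopping_distance (m n : nat) (M : 'M['F_2]_(m, n)) : \bar int :=
  \big[Order.min/+oo%E]_(V : {set 'I_n} | stopping_set M V) (#|V|%:Z)%:E.

(* Main.v *)
(* If a stopping set V had at most D + 1 columns, enlarge it to a set C of exactly
   D + 1 columns and designate a column of V: the row given by disjunctness has
   weight 1 on C at a column of V, hence weight exactly 1 on V. *)
Require Import Defs.
From mathcomp Require Import all_boot all_order all_algebra.
From mathcomp Require Import constructive_ereal.

Import Order.TTheory GRing.Theory Num.Theory.
Local Open Scope ring_scope.

(** Pad [A] with [k - #|A|] distinct elements of its complement, which is large enough because
    [k <= #|T|]. *)
Lemma exists_superset_of_card (T : finType) (A : {set T}) (k : nat) :
  (#|A| <= k <= #|T|)%N -> exists2 B : {set T}, A \subset B & #|B| = k.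
Proof.
case/andP=> leAk lekT.
have: (k - #|A| <= #|~: A|)%N by rewrite -(leq_add2l #|A|) cardsC subnKC.
case/card_geqP=> s [uniq_s size_s sA'].
exists (A :|: [set x in s]); first exact: subsetUl.
rewrite cardsU (_ : A :&: [set x in s] = set0).
  by rewrite cards0 subn0 cardsE (card_uniqP uniq_s) size_s subnKC.
apply/setP=> x; rewrite !inE; apply/negbTE/negP=> /andP[xA /sA'].
by rewrite inE xA.
Qed.

Lemma disjunct_stopping_set_card (D m n : nat) (M : 'M['F_2]_(m, n))
    (V : {set 'I_n}) :
  disjunct D M -> (D.+1 <= n)%N -> stopping_set M V -> (D.+1 < #|V|)%N.
Proof.
move=> hM hn /andP[/set0Pn[j jV] /forallP stopV]; rewrite ltnNge; apply/negP.
move=> leV; have [|C VC cardC] := exists_superset_of_card _ V D.+1.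
  by rewrite leV card_ord.
have [i [Mij Mi0]] := hM C j cardC (subsetP VC j jV).
(* Weight one is witnessed by [[set j]]: any other column of [V] lies in [C :\ j], where row [i]
   vanishes. *)
have/negP[] := stopV i; apply/cards1P; exists j; apply/setP=> k; rewrite !inE.
have [->|nkj] := eqVneq k j; first by rewrite jV Mij eqxx.
case kV: (k \in V) => //=.
by rewrite Mi0 ?inE ?nkj ?(subsetP VC) // eq_sym oner_eq0.
Qed.

Theorem proposition2p3 (D m n : nat) (M : 'M['F_2]_(m, n))
  (hM : disjunct D M) (hn : (D.+1 <= n)%N) :
  (((D + 2)%:Z)%:E <= stopping_distance M)%E.
Proof.
(* The bound holds for the default [+oo], which settles the case without stopping sets, and is
   preserved by [min], so each stopping set can be treated alone. *)
rewrite /stopping_distance; elim/big_ind: _ => [|x y lex ley|V stopV].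
- exact: leey.
- by rewrite le_min lex ley.
- by rewrite lee_fin lez_nat addn2 (disjunct_stopping_set_card _ _ _ _ _ hM).
Qed.
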